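(* Let $f\in\mathcal S^0_{\mu_f}(\mathcal X)$ with $\mu_f\ge0$ and $g\in\mathcal S^0_{\mu_g}(\mathcal Y)$ with $\mu_g>0$, and let $B\ne0$. Let $\beta_k=\frac{\mu_gk^2}{3\|B\|^2}$, $\alpha_k=\frac1k$ and $\epsilon_k=\frac1{\alpha_k\beta_kk^3}$ for $k\ge1$, and suppose that $\delta,\gamma>0$ satisfy $\delta\le\frac13$ and $\delta\gamma-1\ge0$. Let $\{(x_k,y_k,\lambda_k)\}_{k\ge1}$ be the sequence generated by the Primal-dual Splitting Algorithm (defined in the context) with these parameters and let $(x^*,y^*,\lambda^* )\in\Omega$. Then the sequence $\{(x_k,y_k,\lambda_k)\}_{k\ge1}$ is bounded and, as $k\to+\infty$, $$\mathcal L(x_k,y_k,\lambda^* )-\mathcal L(x^*,y^*,\lambda^* )=\mathcal O\!\left(\frac1{k^2}\right),\quad |\Phi(x_k,y_k)-\Phi(x^*,y^* )|=\mathcal O\!\left(\frac1{k^2}\right),\quad \|Ax_k+By_k-b\|=\mathcal O\!\left(\frac1{k^2}\right).$$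
   Context: $\mathcal X,\mathcal Y,\mathcal Z$ are real Hilbert spaces. The problem is $\min_{x\in\mathcal X,y\in\mathcal Y}\Phi(x,y):=f(x)+g(y)$ subject to $Ax+By=b$, where $f:\mathcal X\to\mathbb R\cup\{+\infty\}$, $g:\mathcal Y\to\mathbb R\cup\{+\infty\}$ are proper, convex, lower semicontinuous, $A:\mathcal X\to\mathcal Z$, $B:\mathcal Y\to\mathcal Z$ are continuous linear operators, $b\in\mathcal Z$, and the set $\mathbb S$ of optimal solutions is nonempty. $\mathcal S^0_\mu(\mathcal X)$ ($\mu\ge0$) is the set of proper, closed, lower semicontinuous convex functions $f$ on $\mathcal X$ such that $f(x_1)-f(x_2)-\langle w,x_1-x_2\rangle\ge\frac\mu2\|x_1-x_2\|^2$ for all $x_1,x_2\in\mathcal X$ and $w\in\partial f(x_2)$ (convex subdifferential); similarly for $\mathcal Y$. Lagrangian: $\mathcal L(x,y,\lambda)=f(x)+g(y)+\langle\lambda,Ax+By-b\rangle$. Augmented Lagrangian: $\mathcal L_\theta(x,y,\lambda)=\mathcal L(x,y,\lambda)+\frac\theta2\|Ax+By-b\|^2$. $\Omega$ is the set of saddle points: $(x^*,y^*,\lambda^* )\in\Omega$ iff $\mathcal L(x^*,y^*,\lambda)\le\mathcal L(x^*,y^*,\lambda^* )\le\mathcal L(x,y,\lambda^* )$ for all $(x,y,\lambda)\in\mathcal X\times\mathcal Y\times\mathcal Z$. Primal-dual Splitting Algorithm. Parameters: $\delta>0$, $\gamma>0$, sequences $\alpha_k>0$, $\beta_k>0$, $\epsilon_k\ge0$.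 Initialize $x_1=x_0=\frac1\gamma Z_1$, $y_1=y_0=\frac1\gamma H_1$, $\lambda_1=\lambda_0$. For $k=1,2,\dots$: Step 1: $\theta_k=(\alpha_k+\delta)\beta_k$, $\eta_{f,k}=\gamma+\frac1{\alpha_k}+\mu_f\delta\beta_k$, $\widetilde\lambda_{1,k}=\lambda_k-\delta\beta_k(Ax_k+By_k-b)+\delta\alpha_k\beta_kB(H_k-\gamma y_k)$, $\widetilde x_k=x_k+\frac{Z_k-\gamma x_k}{\eta_{f,k}}$, $$x_{k+1}=\arg\min_{x\in\mathcal X}\Big(\mathcal L_{\theta_k}(x,y_k,\widetilde\lambda_{1,k})+\frac{\eta_{f,k}}{2\alpha_k\beta_k}\|x-\widetilde x_k\|^2+\frac{\epsilon_k}2\|x\|^2\Big),$$ $Z_{k+1}=\frac{x_{k+1}-x_k}{\alpha_k}+\gamma x_{k+1}$, $Z^\delta_{k+1}=\delta Z_{k+1}+(1-\delta\gamma)x_{k+1}$. Step 2: $\eta_{g,k}=\gamma+\frac1{\alpha_k}+\mu_g\delta\beta_k$, $\widetilde\lambda_{2,k}=\lambda_k-\delta\beta_k(Ax_k+By_k-b)$, $\widetilde y_k=y_k+\frac{H_k-\gamma y_k}{\eta_{g,k}}$, $$y_{k+1}=\arg\min_{y\in\mathcal Y}\Big(\mathcal L_{\theta_k}(x_{k+1},y,\widetilde\lambda_{2,k})+\frac{\eta_{g,k}}{2\alpha_k\beta_k}\|y-\widetilde y_k\|^2+\frac{\epsilon_k}2\|y\|^2\Big),$$ $H_{k+1}=\frac{y_{k+1}-y_k}{\alpha_k}+\gamma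 y_{k+1}$, $H^\delta_{k+1}=\delta H_{k+1}+(1-\delta\gamma)y_{k+1}$. Step 3: $\lambda_{k+1}=\lambda_k+\alpha_k\beta_k(AZ^\delta_{k+1}+BH^\delta_{k+1}-b)$. *)

(* Defs.v *)
From HB Require Import structures.
From mathcomp Require Import all_boot all_order all_algebra sesquilinear.
From mathcomp Require Import all_classical all_reals all_analysis.

Set Implicit Arguments.
Unset Strict Implicit.
Unset Printing Implicit Defensive.

Import Order.TTheory GRing.Theory Num.Theory.
Import numFieldNormedType.Exports.

Local Open Scope classical_set_scope.
Local Open Scope ring_scope.

(* A real Hilbert space is a complete normed module X together with an inner
   product [ip] that induces its norm. *)
Definition induces_norm (R : realType) (X : completeNormedModType R)
    (ip : {dot X for @idfun R}) : Prop :=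
  forall u : X, ip u u = `|u| ^+ 2.

Definition opnorm (R : realType) (Y Z : normedModType R) (B : Y -> Z) : R :=
  sup [set `|B y| | y in [set y : Y | `|y| <= 1]].

Section convex_functions.
Context (R : realType) (X : completeNormedModType R) (ip : {dot X for @idfun R}).
Implicit Types f F : X -> \bar R.
Local Open Scope ereal_scope.

Definition proper_efun f : Prop :=
  (forall x, f x != -oo) /\ (exists x, f x != +oo).

Definition convex_efun f : Prop :=
  forall (x y : X) (t : R), (0 <= t <= 1)%R ->
    f (t *: x + (1 - t) *: y)%R <= t%:E * f x + (1 - t)%:E * f y.

(* The epigraph is closed. This is equivalent to lower semicontinuity; the class
   below lists both. *)
Definition closed_efun f : Prop :=
  closed [set p : X * R | f p.1 <= p.2%:E].

(* For proper [f] this set is empty as soon as [f x = +oo]. *)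
Definition subdifferential f (x : X) : set X :=
  [set w | forall y, f x + (ip w (y - x)%R)%:E <= f y].

Definition strongly_convex_class (mu : R) f : Prop :=
  [/\ proper_efun f, closed_efun f, lower_semicontinuous f, convex_efun f &
      forall x1 x2 w : X, subdifferential f x2 w ->
        (mu / 2 * `|x1 - x2| ^+ 2)%:E
          <= f x1 - f x2 - (ip w (x1 - x2)%R)%:E].

(* The minimal value is required to be less than +oo: a function that is identically
   +oo has no minimizer. *)
Definition argmin F : set X :=
  [set x | F x < +oo /\ forall x', F x <= F x'].

End convex_functions.

Section problem.
Context (R : realType) (X Y Z : completeNormedModType R).
Context (ipZ : {dot Z for @idfun R}).
Context (f : X -> \bar R) (g : Y -> \bar R).
Context (A : {linear X -> Z}) (B : {linear Y -> Z}) (b : Z).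
Local Open Scope ereal_scope.

Definition objective (x : X) (y : Y) : \bar R := f x + g y.

Definition optimal_solutions : set (X * Y) :=
  [set p | (A p.1 + B p.2 = b)%R /\
           forall x y, (A x + B y = b)%R -> objective p.1 p.2 <= objective x y].

Definition lagrangian (x : X) (y : Y) (lam : Z) : \bar R :=
  f x + g y + (ipZ lam (A x + B y - b)%R)%:E.

Definition augmented_lagrangian (theta : R) (x : X) (y : Y) (lam : Z) : \bar R :=
  lagrangian x y lam + (theta / 2 * `|A x + B y - b| ^+ 2)%:E.

Definition saddle_points : set (X * Y * Z) :=
  [set p | let: (xs, ys, ls) := p in
    forall x y l, lagrangian xs ys l <= lagrangian xs ys ls /\
                  lagrangian xs ys ls <= lagrangian x y ls].

(* Sequences are indexed from 0, but [Zs] and [Hs] (the momentum sequences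
   Z_k and H_k) and the parameters are only used from index 1 on. *)
Record primal_dual_splitting (muf mug delta gamma : R)
    (alpha beta eps : nat -> R) (x : nat -> X) (y : nat -> Y) (lam : nat -> Z)
    (Zs : nat -> X) (Hs : nat -> Y) : Prop := PrimalDualSplitting {
  pds_init_x : x 1%N = x 0%N /\ x 0%N = (gamma^-1 *: Zs 1%N)%R ;
  pds_init_y : y 1%N = y 0%N /\ y 0%N = (gamma^-1 *: Hs 1%N)%R ;
  pds_init_lam : lam 1%N = lam 0%N ;
  pds_x : forall k, (1 <= k)%N ->
    let theta := ((alpha k + delta) * beta k)%R in
    let eta := (gamma + (alpha k)^-1 + muf * delta * beta k)%R in
    let lamt := (lam k - (delta * beta k) *: (A (x k) + B (y k) - b)
                 + (delta * alpha k * beta k) *: B (Hs k - gamma *: y k))%R in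
    let xt := (x k + eta^-1 *: (Zs k - gamma *: x k))%R in
    argmin (fun x' => augmented_lagrangian theta x' (y k) lamt
              + (eta / (2 * alpha k * beta k) * `|x' - xt| ^+ 2)%:E
              + (eps k / 2 * `|x'| ^+ 2)%:E) (x k.+1) ;
  pds_Z : forall k, (1 <= k)%N ->
    Zs k.+1 = ((alpha k)^-1 *: (x k.+1 - x k) + gamma *: x k.+1)%R ;
  pds_y : forall k, (1 <= k)%N ->
    let theta := ((alpha k + delta) * beta k)%R in
    let eta := (gamma + (alpha k)^-1 + mug * delta * beta k)%R in
    let lamt := (lam k - (delta * beta k) *: (A (x k) + B (y k) - b))%R in
    let yt := (y k + eta^-1 *: (Hs k - gamma *: y k))%R in
    argmin (fun y' => augmented_lagrangian theta (x k.+1) y' lamt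
              + (eta / (2 * alpha k * beta k) * `|y' - yt| ^+ 2)%:E
              + (eps k / 2 * `|y'| ^+ 2)%:E) (y k.+1) ;
  pds_H : forall k, (1 <= k)%N ->
    Hs k.+1 = ((alpha k)^-1 *: (y k.+1 - y k) + gamma *: y k.+1)%R ;
  pds_lam : forall k, (1 <= k)%N ->
    let Zdelta := (delta *: Zs k.+1 + (1 - delta * gamma) *: x k.+1)%R in
    let Hdelta := (delta *: Hs k.+1 + (1 - delta * gamma) *: y k.+1)%R in
    lam k.+1 = (lam k + (alpha k * beta k) *: (A Zdelta + B Hdelta - b))%R
}.

End problem.

(* For an extended-real sequence, being O(v) includes being eventually finite. *)
Definition ereal_bigO (R : realType) (u : nat -> \bar R) (v : nat -> R) : Prop :=
  (\forall k \near \oo, u k \is a fin_num) /\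
  (fun k => fine (u k) : R^o) =O_\oo (v : nat -> R^o).

(* Main.v *)
(* Discrete Lyapunov argument. With X_k = x_k + delta (Z_k - gamma x_k), and Y_k
   likewise, the optimality conditions of the two subproblems say that the
   x-subproblem sees the multiplier
   lambda_{k+1} - alpha_k beta_k B (Y_{k+1} - Y_k) and the y-subproblem sees
   lambda_{k+1}. Testing the subgradients against X_{k+1} - x* and Y_{k+1} - y*
   yields a telescoping estimate for
     delta beta_k (L(x_k,y_k,l* ) - L* ) + |lambda_k - l*|^2 / 2
     + (|X_k - x*|^2 + |Y_k - y*|^2) / (2 delta)
     + (delta gamma - 1) / (2 delta) (|x_k - x*|^2 + |y_k - y*|^2)
     + (alpha_k beta_k)^2 / 2 |B (Y_k - y* )|^2
     + delta beta_k eps_k / 2 (|x_k|^2 + |y_k|^2),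
   where the growth of the penultimate term is absorbed by the strong convexity
   of g, and the Tikhonov terms only leave a summable error of order 1/k^3.
   Boundedness of this energy gives the rate of the Lagrangian gap. The residual
   r_k is recovered from the multipliers: delta beta_{k+1} r_{k+1} - (lambda_{k+1} - l* )
   is a convex combination of delta beta_k r_k - (lambda_k - l* ) and
   -(lambda_{k+1} - l* ), hence bounded. *)
Require Import Defs.
From mathcomp Require Import all_boot all_order all_algebra sesquilinear.
From mathcomp Require Import all_classical all_reals all_analysis.
From mathcomp Require Import ring lra.
Import Order.TTheory GRing.Theory Num.Theory.
Import numFieldNormedType.Exports.

Set Implicit Arguments.
Unset Strict Implicit.
Unset Printing Implicit Defensive.

Local Open Scope classical_set_scope.
Local Open Scope ring_scope.

(** * Hilbert spaces *)

Section dot_product.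
Context (R : realType) (X : completeNormedModType R) (ip : {dot X for @idfun R}).

Lemma dotC u v : ip u v = ip v u.
Proof. by have := hermC ip u v; rewrite expr0 mul1r. Qed.

Lemma dotDl u v w : ip (u + v) w = ip u w + ip v w.
Proof. exact: linearDl. Qed.

Lemma dotNl u v : ip (- u) v = - ip u v.
Proof. exact: linearNl. Qed.

Lemma dotZl a u v : ip (a *: u) v = a * ip u v.
Proof. exact: linearZl_LR. Qed.

Lemma dotDr u v w : ip u (v + w) = ip u v + ip u w.
Proof. exact: linearDr. Qed.

Lemma dotNr u v : ip u (- v) = - ip u v.
Proof. exact: linearNr. Qed.

Lemma dotZr a u v : ip u (a *: v) = a * ip u v.
Proof. exact: linearZr_LR. Qed.

Definition dotE := (dotDl, dotNl, dotZl, dotDr, dotNr, dotZr).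

Hypothesis hip : induces_norm ip.

Lemma dot_ge0 u : 0 <= ip u u.
Proof. by rewrite hip exprn_ge0. Qed.

(** Cauchy-Schwarz: the squared norm of [ip v v *: u - ip u v *: v] is [ip v v] times the difference
    of the two sides. *)
Lemma sqr_dot_le u v : ip u v ^+ 2 <= ip u u * ip v v.
Proof.
have [->|v0] := eqVneq v 0.
  by rewrite (linear0r ip) expr0n /= (linear0r ip) mulr0.
have vv : 0 < ip v v by rewrite hip exprn_gt0 // normr_gt0.
have := dot_ge0 (ip v v *: u - ip u v *: v).
rewrite !dotE (dotC v u) => h.
rewrite -subr_ge0 -(pmulr_rge0 _ vv); apply: le_trans h _.
by rewrite le_eqVlt; apply/orP; left; apply/eqP; ring.
Qed.

Lemma dot_le_norm u v : `|ip u v| <= `|u| * `|v|.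
Proof.
rewrite -(ler_pXn2r (n := 2)) ?nnegrE ?mulr_ge0 //.
by rewrite real_normK ?num_real // exprMn -!hip sqr_dot_le.
Qed.

End dot_product.

(** A negative [a] would dominate the quadratic term for small [t]. This turns minimality along a
    segment into a first-order condition. *)
Lemma quadratic_ge0 (R : realFieldType) (a b : R) :
  (forall t, 0 < t <= 1 -> 0 <= t * a + t ^+ 2 * b) -> 0 <= a.
Proof.
move=> h; rewrite leNgt; apply/negP => a0.
have c0 : 0 < - a + `|b| + 1 by have := normr_ge0 b; lra.
(* This t makes a + t |b| equal to -t (1 - a) < 0. *)
have := h (- a / (- a + `|b| + 1)).
rewrite divr_gt0 ?oppr_gt0 // ler_pdivrMr // mul1r => /(_ ltac:(have := normr_ge0 b; lra)).
set t := _ / _ => ht.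
have t0 : 0 < t by rewrite divr_gt0 ?oppr_gt0.
have tc : t * (- a + `|b| + 1) = - a by rewrite divfK ?gt_eqF.
have : 0 <= t * (a + t * b) by rewrite mulrDr mulrA -expr2.
rewrite pmulr_rge0 // => ab.
have : t * b <= t * `|b| by rewrite ler_pM2l // ler_norm.
have : 0 < t * (1 - a) by rewrite mulr_gt0 //; lra.
lra.
Qed.

(* The representative is the minimizer of [u |-> |u|^2 / 2 - phi u]; the
   parallelogram law makes minimizing sequences Cauchy. *)
Lemma riesz_representation (R : realType) (X : completeNormedModType R)
    (ip : {dot X for @idfun R}) (hip : induces_norm ip) (phi : X -> R) (M : R) :
  (forall a u v, phi (a *: u + v) = a * phi u + phi v) ->
  (forall u, `|phi u| <= M * `|u|) ->
  exists w, forall u, phi u = ip w u.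
Proof.
move=> philin phibd.
have phi0 : phi 0 = 0.
  by have := philin (-1) 0 0; rewrite scaler0 addr0 => ->; ring.
have phiD u v : phi (u + v) = phi u + phi v.
  by rewrite -[u]scale1r philin mul1r scale1r.
have phiZ a u : phi (a *: u) = a * phi u.
  by rewrite -[a *: u]addr0 philin phi0 addr0.
pose J u := ip u u / 2 - phi u.
pose E := range J.
have J_ge u : - M ^+ 2 / 2 <= J u.
  rewrite /J hip; have := ler_norm (phi u); have := phibd u.
  have := sqr_ge0 (`|u| - M); rewrite sqrrB => *; lra.
have lbE : has_lbound E by exists (- M ^+ 2 / 2) => _ [u _ <-].
have infE : has_inf E by split => //; exists (J 0); exists 0.
have /choice[u_ Ju] n : exists u, J u < inf E + n.+1%:R^-1.
  have [_ [u _ <-] ?] := @inf_adherent _ E n.+1%:R^-1 (ltac:(by rewrite invr_gt0)) infE.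
  by exists u.
have infJ u : inf E <= J u by apply: ge_inf => //; exists u.
(* Parallelogram law: [phi] cancels, and [J] at the midpoint is at least [inf E]. *)
have dist u v : `|u - v| ^+ 2 <= 4 * (J u + J v - 2 * inf E).
  have := infJ (2^-1 *: (u + v)).
  rewrite -hip /J phiZ phiD !(dotE, dotC ip v u) => h; lra.
have uC : cvg (u_ @ \oo).
  apply/cauchy_cvgP/cauchy_exP => e e0.
  have e8 : 0 < e ^+ 2 / 8 by rewrite divr_gt0 ?exprn_gt0.
  have [N _ HN] := near_infty_natSinv_lt (PosNum e8).
  exists (u_ N); exists N => // n /= Nn.
  rewrite /= -ball_normE /= -(ltr_pXn2r (n := 2)) ?nnegrE ?(ltW e0) //.
  apply: le_lt_trans (dist _ _) _.
  have /= h1 := HN n Nn; have /= h2 := HN N (leqnn N).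
  have := Ju n; have := Ju N.
  move: h1 h2; set i := n.+1%:R^-1; set j := N.+1%:R^-1; lra.
pose p := lim (u_ @ \oo).
have Jp : J p <= inf E.
  apply/ler_addgt0Pr => e e0.
  (* With p = u_n + d and |d| < 1, the increment J(p) - J(u_n) = <u_n, d> + |d|^2 / 2 - phi(d) is at
     most c |d|. *)
  pose c := `|p| + `|M| + 2.
  have c0 : 0 < c by rewrite /c; have := normr_ge0 p; have := normr_ge0 M; lra.
  have d0 : 0 < Num.min 1 (e / 2 / c) by rewrite lt_min ltr01 !divr_gt0.
  have e20 : 0 < e / 2 by rewrite divr_gt0.
  have [n [/= nd ne]] : exists n, `|p - u_ n| < Num.min 1 (e / 2 / c) /\ n.+1%:R^-1 < e / 2.
    have near1 : \forall n \near \oo, `|p - u_ n| < Num.min 1 (e / 2 / c).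
      by move/cvgrPdist_lt : uC; apply.
    have near2 := near_infty_natSinv_lt (PosNum e20).
    by have [n ?] := filter_ex (filterI near1 near2); exists n.
  move: nd; rewrite lt_min => /andP[d1]; rewrite ltr_pdivlMr // => dc.
  have [d pd] : exists d, p - u_ n = d by exists (p - u_ n).
  rewrite pd in d1 dc; rewrite -(subrK (u_ n) p) pd addrC.
  have un : `|u_ n| <= `|p| + 1.
    by have := ler_normB p d; rewrite -pd subKr pd; lra.
  have : ip (u_ n) d <= (`|p| + 1) * `|d|.
    apply: le_trans (ler_norm _) _; apply: le_trans (dot_le_norm hip _ _) _.
    by rewrite ler_wpM2r.
  have : - phi d <= `|M| * `|d|.
    apply: le_trans (ler_norm _) _; rewrite normrN; apply: le_trans (phibd _) _.
    by rewrite ler_wpM2r // ler_norm.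
  have : ip d d <= `|d|.
    by rewrite hip expr2 ler_piMr // ltW.
  have := Ju n; move: dc; rewrite /J /c phiD !(dotE, dotC ip d (u_ n)).
  have := normr_ge0 d; move: ne; move: n.+1%:R^-1 => i; lra.
exists p => u.
have h v : 0 <= ip p v - phi v.
  apply: (@quadratic_ge0 _ _ (ip v v / 2)) => t _.
  have := le_trans Jp (infJ (p + t *: v)).
  rewrite /J phiD phiZ !(dotE, dotC ip v p); lra.
apply/eqP; rewrite -subr_eq0 eq_le; apply/andP; split.
  have := h u; lra.
have := h (- u); rewrite -scaleN1r phiZ dotZr; lra.
Qed.

(** * Minimization of penalized convex functions *)

Section convex_minimization.
Context (R : realType) (X : completeNormedModType R) (ip : {dot X for @idfun R}).
Hypothesis hip : induces_norm ip.

(** Minimality is compared with the convexity bound at p + t (y - p); the terms of first order in t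
    say that -L is a subgradient functional of f at p. *)
Lemma argmin_first_order (f : X -> \bar R) (J L Q : X -> R) (p : X) :
  proper_efun f -> convex_efun f ->
  argmin (fun x => f x + (J x)%:E)%E p ->
  (forall h t, J (p + t *: h) = J p + t * L h + t ^+ 2 * Q h) ->
  f p \is a fin_num /\ forall y, (f p + (- L (y - p))%:E <= f y)%E.
Proof.
move=> [fNy _] fconv [Fp Fmin] JE.
have fpfin : f p \is a fin_num.
  rewrite fin_numE fNy /=; apply/eqP => fpy.
  by move: Fp; rewrite fpy addye.
split=> // y.
have [fyfin|] := boolP (f y \is a fin_num); last first.
  by rewrite fin_numE fNy /= negbK => /eqP ->; rewrite leey.
rewrite -(fineK fpfin) -(fineK fyfin) -EFinD lee_fin -subr_ge0.
rewrite opprD opprK addrA; apply: (@quadratic_ge0 _ _ (Q (y - p))) => t /andP[t0 t1].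
have := fconv y p t; rewrite (ltW t0) t1 => /(_ isT) cvx.
have := Fmin (p + t *: (y - p)).
have <- : t *: y + (1 - t) *: p = p + t *: (y - p).
  by rewrite scalerBr scalerBl scale1r addrCA.
rewrite {2}[t *: y + _](_ : _ = p + t *: (y - p)); last first.
  by rewrite scalerBr scalerBl scale1r addrCA.
rewrite JE => Fle.
have := le_trans Fle (leeD2r (J p + t * L (y - p) + t ^+ 2 * Q (y - p))%:E cvx).
rewrite -(fineK fpfin) -(fineK fyfin) -!EFinM -!EFinD lee_fin => h.
nra.
Qed.

(* Testing the optimality condition at [u] and at [x0] with the weights
   [alpha * beta] and [delta * beta] amounts to testing it against the
   extrapolated point [x1 + delta V1 - u]. *)
Lemma proximal_step_descent (f : X -> \bar R) (mu alpha beta delta gamma eps M : R)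
    (phi J Q : X -> R) (u x0 x1 V0 V1 : X) :
  let eta := gamma + alpha^-1 + mu * delta * beta in
  let xt := x0 + eta^-1 *: V0 in
  0 <= mu -> 0 < alpha -> 0 < beta -> 0 < delta -> 0 < gamma ->
  0 <= delta * gamma - 1 -> 0 <= eps ->
  strongly_convex_class ip mu f ->
  (forall a v w, phi (a *: v + w) = a * phi v + phi w) ->
  (forall v, `|phi v| <= M * `|v|) ->
  argmin (fun x => f x + (J x)%:E)%E x1 ->
  (forall h t, J (x1 + t *: h) = J x1
     + t * (phi h + eta / (alpha * beta) * ip (x1 - xt) h + eps * ip x1 h)
     + t ^+ 2 * Q h) ->
  x1 - x0 = alpha *: V1 ->
  f u \is a fin_num -> f x0 \is a fin_num ->
  alpha * beta * (fine (f x1) - fine (f u))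
  + delta * beta * (fine (f x1) - fine (f x0))
  + alpha * beta * phi (x1 + delta *: V1 - u)
  + (2 * delta)^-1 * (`|x1 + delta *: V1 - u| ^+ 2 - `|x0 + delta *: V0 - u| ^+ 2)
  + (delta * gamma - 1) / (2 * delta) * (`|x1 - u| ^+ 2 - `|x0 - u| ^+ 2)
  + alpha * beta * mu / 2 * `|x1 + delta *: V1 - u| ^+ 2
  + alpha * beta * eps / 2 * (`|x1| ^+ 2 - `|u| ^+ 2)
  + delta * beta * eps / 2 * (`|x1| ^+ 2 - `|x0| ^+ 2) <= 0.
Proof.
move=> eta xt mu0 a0 b0 d0 g0 dg0 e0 [fprop _ _ fconv fsub] philin phibd fmin JE x10 fu fx0.
have [f1 fopt] := argmin_first_order fprop fconv fmin JE.
have phi0 : phi 0 = 0.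
  by have := philin (-1) 0 0; rewrite scaler0 addr0 => ->; ring.
have phiD v w : phi (v + w) = phi v + phi w.
  by rewrite -[v]scale1r philin mul1r scale1r.
have phiZ a v : phi (a *: v) = a * phi v.
  by rewrite -[a *: v]addr0 philin phi0 addr0.
(* Riesz turns [phi] into a vector, so that minus the gradient of [J] at [x1] is a subgradient of
   [f]. *)
have [w0 hw0] := riesz_representation hip philin phibd.
pose w := - (w0 + (eta / (alpha * beta)) *: (x1 - xt) + eps *: x1).
have hw h : ip w h = - (phi h + eta / (alpha * beta) * ip (x1 - xt) h + eps * ip x1 h).
  by rewrite /w hw0 (dotNl ip) !(dotDl ip _ _ h) (dotZl ip) (dotZl ip) (dotDl ip).
have wsub : subdifferential ip f x1 w by move=> y; rewrite hw; exact: fopt.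
have := fsub u _ _ wsub; have := fsub x0 _ _ wsub.
rewrite -(fineK f1) -(fineK fu) -(fineK fx0) -!EFinB !lee_fin !fineK //.
move: (fine _) (fine _) (fine _) => Fu F1 F0.
have etaN0 : eta != 0.
  rewrite gt_eqF // /eta; have : 0 < alpha^-1 by rewrite invr_gt0.
  have : 0 <= mu * delta * beta by rewrite !mulr_ge0 // ltW.
  lra.
rewrite !hw /xt.
(* Everything is expressed through d = x1 - u, V0, V1 and x1. *)
have [d ->] : exists d, u = x1 - d by exists (x1 - u); rewrite subKr.
have -> : x0 = x1 - alpha *: V1 by rewrite -x10 subKr.
have -> : x1 - alpha *: V1 - x1 = - (alpha *: V1) by rewrite addrAC subrr add0r.
have -> : x1 - d - x1 = - d by rewrite addrAC subrr add0r.
have -> : x1 - (x1 - alpha *: V1 + eta^-1 *: V0) = alpha *: V1 - eta^-1 *: V0.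
  by rewrite !opprD opprK !addrA subrr add0r.
have -> : x1 + delta *: V1 - (x1 - d) = d + delta *: V1.
  by rewrite addrC opprB -!addrA addKr.
have -> : x1 - alpha *: V1 + delta *: V0 - (x1 - d) = d - alpha *: V1 + delta *: V0.
  by rewrite addrC opprB -!addrA addKr.
have -> : x1 - alpha *: V1 - (x1 - d) = d - alpha *: V1.
  by rewrite addrC opprB -!addrA addKr.
have phiN v : phi (- v) = - phi v by rewrite -scaleN1r phiZ mulN1r.
rewrite !phiN !phiD !phiZ -!hip !(dotE ip).
rewrite (dotC ip d V1) (dotC ip d V0) (dotC ip V1 V0) (dotC ip x1 d) (dotC ip x1 V1).
have := dot_ge0 hip V1; have := dot_ge0 hip d.
(* The slack consists of this square, |X1 - X0|^2 with Xi = xi + delta Vi, and of |V1|^2 and |d|^2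
   with the coefficients [r0] and [r1] below. *)
have := dot_ge0 hip (alpha *: V1 + delta *: V1 - delta *: V0).
rewrite !(dotE ip) (dotC ip V1 V0).
have gE : gamma = eta - alpha^-1 - mu * delta * beta by rewrite /eta; ring.
have r0 : 0 <= (delta * gamma - 1) * (alpha ^+ 2 / (2 * delta) + alpha)
    + mu * alpha * beta * delta / 2 * (alpha + delta) + delta * beta * eps / 2 * alpha ^+ 2.
  apply: addr_ge0; last by rewrite !mulr_ge0 ?exprn_ge0 ?invr_ge0 ?(ltW a0) ?(ltW b0) ?(ltW d0).
  apply: addr_ge0.
    by rewrite mulr_ge0 // ltW // addr_gt0 // !mulr_gt0 ?exprn_gt0 ?invr_gt0 ?mulr_gt0.
  by rewrite !mulr_ge0 ?invr_ge0 ?addr_ge0 ?(ltW a0) ?(ltW b0) ?(ltW d0).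
have r1 : 0 <= alpha * beta * eps / 2.
  by rewrite !mulr_ge0 ?invr_ge0 ?(ltW a0) ?(ltW b0).
move: (phi d) (phi V1) => pd p1.
move: (ip d d) (ip V1 V1) (ip V0 V0) (ip V1 d) (ip V0 d) (ip V0 V1) (ip d x1) (ip V1 x1) (ip x1 x1).
move=> dd v11 v00 v1d v0d v01 dx v1x xx; set sq := (_ + _ - _).
move=> sq0 dd0 v110 h0 hu.
rewrite -subr_ge0 in h0; rewrite -subr_ge0 in hu; rewrite -oppr_ge0.
set s0 := (_ - _) in h0; set su := (_ - _) in hu.
have := mulr_ge0 (ltW (mulr_gt0 a0 b0)) hu; have := mulr_ge0 (ltW (mulr_gt0 d0 b0)) h0.
have := mulr_ge0 r0 v110; have := mulr_ge0 r1 dd0.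
have : 0 <= (2 * delta)^-1 * sq by rewrite mulr_ge0 // invr_ge0 mulr_ge0 // ltW.
do 4 (move=> /addr_ge0 /[apply]); move=> /le_trans; apply.
(* The two weighted subgradient inequalities and the three squares add up to minus the left-hand
   side. *)
rewrite le_eqVlt; apply/orP; left; apply/eqP.
rewrite /s0 /su /sq gE; move: (eta) etaN0 => e eN0; field.
by rewrite eN0 !gt_eqF.
Qed.
End convex_minimization.

(** * Continuous linear maps and the operator norm *)

Section continuous_linear_maps.
Context (R : realType) (V W : normedModType R) (T : {linear V -> W}).
Hypothesis cT : continuous T.

Lemma continuous_linear_le : exists2 M, 0 <= M & forall v, `|T v| <= M * `|v|.
Proof.
have /linear_boundedP : bounded_near T (nbhs (0 : V)) by apply/linear_bounded_continuous.
move=> [M [Mr HM]]; exists (`|M| + 1); first by rewrite addr_ge0.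
by apply: HM; rewrite (le_lt_trans (ler_norm M)) // ltrDl.
Qed.

(** Continuity bounds the image of the unit ball, so the supremum in [opnorm] is a genuine upper
    bound. *)
Lemma le_opnorm v : `|T v| <= opnorm T * `|v|.
Proof.
have [M M0 HM] := continuous_linear_le.
have [->|v0] := eqVneq v 0; first by rewrite linear0 !normr0 mulr0.
have nv : 0 < `|v| by rewrite normr_gt0.
rewrite -ler_pdivrMr //; apply: sup_upper_bound.
  split; first by exists `|T 0|, 0; rewrite //= normr0.
  exists M => _ [u /= u1 <-]; apply: le_trans (HM u) _.
  by rewrite ler_piMr.
exists (`|v|^-1 *: v) => /=.
  by rewrite normrZ normfV normr_id mulVf ?gt_eqF.
by rewrite linearZ normrZ normfV normr_id mulrC.
Qed.

Lemma opnorm_gt0 : (exists v, T v != 0) -> 0 < opnorm T.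
Proof.
move=> [v Tv0]; have Tv : 0 < `|T v| by rewrite normr_gt0.
have := lt_le_trans Tv (le_opnorm v).
have [->|v0] := eqVneq v 0; first by rewrite normr0 mulr0 ltxx.
by rewrite pmulr_lgt0 // normr_gt0.
Qed.

End continuous_linear_maps.

(** The right side minus the left is c^2 / 2 |a + q|^2. This turns the error caused by the lagged
    Y_k in the x-subproblem into differences of squares. *)
Lemma multiplier_cross_term (R : realType) (Z : completeNormedModType R)
    (ip : {dot Z for @idfun R}) (hip : induces_norm ip) (l a p q : Z) (c : R) :
  (`|l| ^+ 2 - `|l - c *: (a + p)| ^+ 2) / 2 + c ^+ 2 / 2 * (`|p| ^+ 2 - `|q| ^+ 2)
  <= c * ip l (a + p) - c ^+ 2 * ip (p - q) a.
Proof.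
have := mulr_ge0 (sqr_ge0 c) (dot_ge0 hip (a + q)).
rewrite -!hip !(dotE ip) (dotC ip l a) (dotC ip l p) (dotC ip p a) (dotC ip q a); lra.
Qed.

(** * Descent estimate common to both subproblems *)

Section penalized_step.
Context (R : realType) (X Z : completeNormedModType R).
Context (ip : {dot X for @idfun R}) (ipZ : {dot Z for @idfun R}).
Hypotheses (hip : induces_norm ip) (hipZ : induces_norm ipZ).
Variables (T : {linear X -> Z}) (f : X -> \bar R).
Hypothesis cT : continuous T.

(** The expansion is exact. [mult] stands for [lamt + theta *: (T x1 + e)], the multiplier corrected
    by the penalty at [x1]. *)
Lemma penalized_quadratic (e lamt mult : Z) (c theta kap eps : R) (xt x1 h : X) (t : R) :
  let J x := c + ipZ lamt (T x + e) + theta / 2 * `|T x + e| ^+ 2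
             + kap / 2 * `|x - xt| ^+ 2 + eps / 2 * `|x| ^+ 2 in
  (forall v, ipZ mult v = ipZ lamt v + theta * ipZ (T x1 + e) v) ->
  J (x1 + t *: h) = J x1
    + t * (ipZ mult (T h) + kap * ip (x1 - xt) h + eps * ip x1 h)
    + t ^+ 2 * (theta / 2 * `|T h| ^+ 2 + (kap + eps) / 2 * `|h| ^+ 2).
Proof.
move=> J hm; rewrite /J hm.
have -> : T (x1 + t *: h) + e = (T x1 + e) + t *: T h.
  by rewrite linearD linearZ addrAC.
have -> : x1 + t *: h - xt = (x1 - xt) + t *: h by rewrite addrAC.
move: (T x1 + e) (x1 - xt) (T h) => u v w.
rewrite -!hip -!hipZ !(dotE ip, dotE ipZ) (dotC ipZ w u) (dotC ip h v) (dotC ip h x1).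
by field.
Qed.

(** Serves both subproblems: [T] is the operator of the active block, [e] collects the other block
    and -b, and [c] is the value of the other function. *)
Lemma penalized_step_descent (e lamt mult : Z) (c theta : R)
    (mu alpha beta delta gamma eps : R) (u x0 x1 V0 V1 : X) :
  let eta := gamma + alpha^-1 + mu * delta * beta in
  let xt := x0 + eta^-1 *: V0 in
  0 <= mu -> 0 < alpha -> 0 < beta -> 0 < delta -> 0 < gamma ->
  0 <= delta * gamma - 1 -> 0 <= eps ->
  strongly_convex_class ip mu f ->
  (forall v, ipZ mult v = ipZ lamt v + theta * ipZ (T x1 + e) v) ->
  argmin (fun x => f x + (c + (ipZ lamt (T x + e) + theta / 2 * `|T x + e| ^+ 2
     + eta / (alpha * beta) / 2 * `|x - xt| ^+ 2 + eps / 2 * `|x| ^+ 2))%:E)%E x1 ->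
  x1 - x0 = alpha *: V1 ->
  f u \is a fin_num -> f x0 \is a fin_num ->
  alpha * beta * (fine (f x1) - fine (f u))
  + delta * beta * (fine (f x1) - fine (f x0))
  + alpha * beta * ipZ mult (T (x1 + delta *: V1 - u))
  + (2 * delta)^-1 * (`|x1 + delta *: V1 - u| ^+ 2 - `|x0 + delta *: V0 - u| ^+ 2)
  + (delta * gamma - 1) / (2 * delta) * (`|x1 - u| ^+ 2 - `|x0 - u| ^+ 2)
  + alpha * beta * mu / 2 * `|x1 + delta *: V1 - u| ^+ 2
  + alpha * beta * eps / 2 * (`|x1| ^+ 2 - `|u| ^+ 2)
  + delta * beta * eps / 2 * (`|x1| ^+ 2 - `|x0| ^+ 2) <= 0.
Proof.
move=> eta xt mu0 a0 b0 d0 g0 dg0 e0 hf hm xmin x10 fu fx0.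
have [M M0 HM] := continuous_linear_le cT.
apply: (@proximal_step_descent _ _ _ hip f mu alpha beta delta gamma eps (`|mult| * M)
  (fun v => ipZ mult (T v)) _ _ u x0 x1 V0 V1 mu0 a0 b0 d0 g0 dg0 e0 hf _ _ xmin
  _ x10 fu fx0).
- by move=> a v w; rewrite linearP !(dotE ipZ).
- move=> v; apply: le_trans (dot_le_norm hipZ _ _) _.
  by rewrite -mulrA ler_wpM2l.
- move=> h t; rewrite !addrA.
  exact: penalized_quadratic.
Qed.

End penalized_step.

(** [u k.+1] is a convex combination of [v k] and [u k], so a common bound on [u n] and the [v k]
    propagates. *)
Lemma averaging_bounded (R : realType) (V : normedModType R) (u v : nat -> V)
    (a d : nat -> R) (M : R) (n : nat) :
  (forall k, (n <= k)%N -> 0 <= a k) -> (forall k, (n <= k)%N -> 0 < d k) ->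
  (forall k, (n <= k)%N -> (a k + d k) *: u k.+1 = a k *: v k + d k *: u k) ->
  (forall k, (n <= k)%N -> `|v k| <= M) ->
  forall k, (n <= k)%N -> `|u k| <= Num.max M `|u n|.
Proof.
move=> a0 d0 uE vM; elim=> [|k IH]; first by rewrite leqn0 => /eqP ->; rewrite le_max lexx orbT.
rewrite leq_eqVlt ltnS => /predU1P[<-|nk]; first by rewrite le_max lexx orbT.
have ad : 0 < a k + d k by rewrite ltr_wpDl ?a0 ?d0.
rewrite -(ler_pM2l ad) -[X in X * `|_|](gtr0_norm ad) -normrZ uE // mulrDl.
apply: le_trans (ler_normD _ _) _; rewrite !normrZ ger0_norm ?a0 // gtr0_norm ?d0 //.
apply: lerD; first by rewrite ler_wpM2l ?a0 // le_max vM.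
by rewrite ler_pM2l ?d0 // IH.
Qed.

(** * The splitting iteration *)

Section saddle_point.
Context (R : realType) (X Y Z : completeNormedModType R) (ipZ : {dot Z for @idfun R}).
Context (f : X -> \bar R) (g : Y -> \bar R) (A : {linear X -> Z}) (B : {linear Y -> Z}).
Context (b : Z) (xs : X) (ys : Y) (ls : Z).
Hypotheses (hipZ : induces_norm ipZ) (pf : proper_efun f) (pg : proper_efun g).
Hypothesis saddle : saddle_points ipZ f g A B b (xs, ys, ls).

Lemma saddle_point_fin : f xs \is a fin_num /\ g ys \is a fin_num.
Proof.
have [[fNy [x fx]] [gNy [y gy]]] := (pf, pg).
have [_] := saddle x y ls; rewrite /lagrangian !fin_numE !fNy !gNy /=.
have := fNy xs; have := gNy ys; have := fNy x; have := gNy y.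
move: fx gy.
by case: (f x) => // ?; case: (g y) => // ?; case: (f xs) => //; case: (g ys).
Qed.

(** Shifting the multiplier by the residual r raises the Lagrangian by |r|^2, which the first saddle
    inequality allows only for r = 0. *)
Lemma saddle_point_feasible : A xs + B ys = b.
Proof.
have [fx gy] := saddle_point_fin.
have [+ _] := saddle xs ys (ls + (A xs + B ys - b)).
rewrite /lagrangian -(fineK fx) -(fineK gy) -!EFinD lee_fin lerD2l (dotDl ipZ) hipZ.
rewrite gerDl => h; apply/eqP; rewrite -subr_eq0 -normr_eq0 -sqrf_eq0.
by rewrite eq_le h sqr_ge0.
Qed.

Lemma saddle_point_le x y : f x \is a fin_num -> g y \is a fin_num ->
  fine (f xs) + fine (g ys) <= fine (f x) + fine (g y) + ipZ ls (A x + B y - b).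
Proof.
move=> fx gy; have [fxs gys] := saddle_point_fin.
have [_] := saddle x y ls.
rewrite /lagrangian saddle_point_feasible subrr (linear0r ipZ) adde0.
by rewrite -(fineK fxs) -(fineK gys) -(fineK fx) -(fineK gy) -!EFinD lee_fin.
Qed.

End saddle_point.

(** A minimal value below +oo forces the contribution [G] of the other block to be finite; it then
    joins the real-valued terms. *)
Lemma penalized_argmin_fin (R : realType) (X : completeNormedModType R)
    (f F : X -> \bar R) (G : \bar R) (J : X -> R) (p : X) :
  (forall x, f x != -oo)%E -> (G != -oo)%E ->
  (forall x, F x = f x + G + (J x)%:E)%E -> argmin F p ->
  G \is a fin_num /\ argmin (fun x => f x + (fine G + J x)%:E)%E p.
Proof.
move=> fNy GNy FE hF.
have Gfin : G \is a fin_num.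
  rewrite fin_numE GNy /=; apply/eqP => Gy.
  by case: hF => + _; rewrite FE Gy addey // addye.
split=> //; suff -> : (fun x => f x + (fine G + J x)%:E)%E = F by [].
by apply/funext => x; rewrite FE EFinD addeA fineK.
Qed.

Section iteration.
Context (R : realType) (X Y Z : completeNormedModType R).
Context (ipX : {dot X for @idfun R}) (ipY : {dot Y for @idfun R}) (ipZ : {dot Z for @idfun R}).
Context (f : X -> \bar R) (g : Y -> \bar R).
Context (A : {linear X -> Z}) (B : {linear Y -> Z}) (b : Z).
Context (muf mug delta gamma : R) (alpha beta eps : nat -> R).
Context (x : nat -> X) (y : nat -> Y) (lam : nat -> Z) (Zs : nat -> X) (Hs : nat -> Y).
Context (xs : X) (ys : Y) (ls : Z).
Hypotheses (hipX : induces_norm ipX) (hipY : induces_norm ipY) (hipZ : induces_norm ipZ).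
Hypotheses (hA : continuous A) (hB : continuous B).
Hypotheses (muf_ge0 : 0 <= muf) (mug_ge0 : 0 <= mug).
Hypotheses (hf : strongly_convex_class ipX muf f) (hg : strongly_convex_class ipY mug g).
Hypotheses (delta_gt0 : 0 < delta) (gamma_gt0 : 0 < gamma) (dg_ge1 : 0 <= delta * gamma - 1).
Hypotheses (alpha_gt0 : forall k, (1 <= k)%N -> 0 < alpha k).
Hypotheses (beta_gt0 : forall k, (1 <= k)%N -> 0 < beta k).
Hypotheses (eps_ge0 : forall k, (1 <= k)%N -> 0 <= eps k).
Hypothesis halg : primal_dual_splitting ipZ f g A B b muf mug delta gamma
                    alpha beta eps x y lam Zs Hs.
Hypothesis hOmega : saddle_points ipZ f g A B b (xs, ys, ls).

Let pf : proper_efun f. Proof. by case: hf. Qed.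
Let pg : proper_efun g. Proof. by case: hg. Qed.

(** The point Z^delta_k of the algorithm. For k >= 2, Z_k - gamma x_k is the difference quotient
    (x_k - x_{k-1}) / alpha_{k-1}. *)
Definition extrapolated_x k := x k + delta *: (Zs k - gamma *: x k).
Definition extrapolated_y k := y k + delta *: (Hs k - gamma *: y k).
Definition residual k := A (x k) + B (y k) - b.

Lemma x_increment k : (1 <= k)%N -> x k.+1 - x k = alpha k *: (Zs k.+1 - gamma *: x k.+1).
Proof.
move=> k1; rewrite (pds_Z halg k1) addrK scalerA divff ?scale1r //.
by rewrite gt_eqF ?alpha_gt0.
Qed.

Lemma y_increment k : (1 <= k)%N -> y k.+1 - y k = alpha k *: (Hs k.+1 - gamma *: y k.+1).
Proof.
move=> k1; rewrite (pds_H halg k1) addrK scalerA divff ?scale1r //.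
by rewrite gt_eqF ?alpha_gt0.
Qed.

Lemma lam_increment k : (1 <= k)%N -> lam k.+1 =
  lam k + (alpha k * beta k) *: (A (extrapolated_x k.+1) + B (extrapolated_y k.+1) - b).
Proof.
move=> k1; rewrite (pds_lam halg k1) /extrapolated_x /extrapolated_y.
have E (V : lmodType R) (u v : V) :
    delta *: v + (1 - delta * gamma) *: u = u + delta *: (v - gamma *: u).
  by rewrite scalerBl scale1r scalerBr scalerA addrCA.
by rewrite !E.
Qed.

Let halfE (e a c : R) : e / (2 * a * c) = e / (a * c) / 2.
Proof. by rewrite -[2 * a * c]mulrA [2 * _]mulrC invfM mulrA. Qed.

Let linZ (V : lmodType R) (T : {linear V -> Z}) c (v : V) : T (c *: v) = c *: T v.
Proof. exact: linearZ. Qed.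

Let x_argmin k : (1 <= k)%N ->
  let eta := gamma + (alpha k)^-1 + muf * delta * beta k in
  let lamt := lam k - (delta * beta k) *: residual k
              + (delta * alpha k * beta k) *: B (Hs k - gamma *: y k) in
  let xt := x k + eta^-1 *: (Zs k - gamma *: x k) in
  let e := B (y k) - b in
  let theta := (alpha k + delta) * beta k in
  g (y k) \is a fin_num /\
  argmin (fun x' => f x' + (fine (g (y k)) + (ipZ lamt (A x' + e)
     + theta / 2 * `|A x' + e| ^+ 2
     + eta / (alpha k * beta k) / 2 * `|x' - xt| ^+ 2 + eps k / 2 * `|x'| ^+ 2))%:E)%E (x k.+1).
Proof.
move=> k1 eta lamt xt e theta.
apply: penalized_argmin_fin (pds_x halg k1); [by case: pf | by case: pg |].
move=> x'; rewrite /augmented_lagrangian /lagrangian !EFinD !addeA halfE /e !addrA.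
by [].
Qed.

Let y_argmin k : (1 <= k)%N ->
  let eta := gamma + (alpha k)^-1 + mug * delta * beta k in
  let lamt := lam k - (delta * beta k) *: residual k in
  let yt := y k + eta^-1 *: (Hs k - gamma *: y k) in
  let e := A (x k.+1) - b in
  let theta := (alpha k + delta) * beta k in
  f (x k.+1) \is a fin_num /\
  argmin (fun y' => g y' + (fine (f (x k.+1)) + (ipZ lamt (B y' + e)
     + theta / 2 * `|B y' + e| ^+ 2
     + eta / (alpha k * beta k) / 2 * `|y' - yt| ^+ 2 + eps k / 2 * `|y'| ^+ 2))%:E)%E (y k.+1).
Proof.
move=> k1 eta lamt yt e theta.
apply: penalized_argmin_fin (pds_y halg k1); [by case: pg | by case: pf |].
move=> y'; rewrite /augmented_lagrangian /lagrangian !EFinD !addeA halfE /e.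
by rewrite (addrCA (B y')) addrA (addeC (f _)).
Qed.

(** The x-subproblem carries g(y_k) as a constant and the y-subproblem carries f(x_{k+1}), hence the
    index shift. *)
Lemma iterate_fin k : (1 <= k)%N -> g (y k) \is a fin_num /\ f (x k.+1) \is a fin_num.
Proof. by move=> k1; split; [case: (x_argmin k1) | case: (y_argmin k1)]. Qed.

Lemma x_step k : (1 <= k)%N -> f (x k) \is a fin_num ->
  alpha k * beta k * (fine (f (x k.+1)) - fine (f xs))
  + delta * beta k * (fine (f (x k.+1)) - fine (f (x k)))
  + alpha k * beta k * ipZ (lam k.+1 - (alpha k * beta k) *: B (extrapolated_y k.+1 - extrapolated_y k))
      (A (extrapolated_x k.+1 - xs))
  + (2 * delta)^-1 * (`|extrapolated_x k.+1 - xs| ^+ 2 - `|extrapolated_x k - xs| ^+ 2)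
  + (delta * gamma - 1) / (2 * delta) * (`|x k.+1 - xs| ^+ 2 - `|x k - xs| ^+ 2)
  + alpha k * beta k * muf / 2 * `|extrapolated_x k.+1 - xs| ^+ 2
  + alpha k * beta k * eps k / 2 * (`|x k.+1| ^+ 2 - `|xs| ^+ 2)
  + delta * beta k * eps k / 2 * (`|x k.+1| ^+ 2 - `|x k| ^+ 2) <= 0.
Proof.
move=> k1 fx; have [gfin xmin] := x_argmin k1.
have [fxs _] := saddle_point_fin pf pg hOmega.
apply: (penalized_step_descent hipX hipZ hA muf_ge0 (alpha_gt0 k1) (beta_gt0 k1)
  delta_gt0 gamma_gt0 dg_ge1 (eps_ge0 k1) hf _ xmin (x_increment k1) fxs fx).
(* The multiplier seen here is lam_k + alpha_k beta_k (A X_{k+1} + B Y_k - b): the multiplier update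
   with Y_k in place of Y_{k+1}. *)
move=> v; rewrite (lam_increment k1).
have -> : extrapolated_x k.+1 = x k.+1 + delta *: (Zs k.+1 - gamma *: x k.+1) by [].
have -> : extrapolated_y k = y k + delta *: (Hs k - gamma *: y k) by [].
have : x k = x k.+1 - alpha k *: (Zs k.+1 - gamma *: x k.+1).
  by rewrite -x_increment // subKr.
rewrite /residual; move: (Zs k.+1 - _) (Hs k - _) (extrapolated_y k.+1) => V1 W0 YY1.
move=> ->; rewrite !(linearD A, linearD B, linearN A, linearN B, linZ A, linZ B) !(dotE ipZ).
ring.
Qed.

Lemma y_step k : (1 <= k)%N ->
  alpha k * beta k * (fine (g (y k.+1)) - fine (g ys))
  + delta * beta k * (fine (g (y k.+1)) - fine (g (y k)))
  + alpha k * beta k * ipZ (lam k.+1) (B (extrapolated_y k.+1 - ys))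
  + (2 * delta)^-1 * (`|extrapolated_y k.+1 - ys| ^+ 2 - `|extrapolated_y k - ys| ^+ 2)
  + (delta * gamma - 1) / (2 * delta) * (`|y k.+1 - ys| ^+ 2 - `|y k - ys| ^+ 2)
  + alpha k * beta k * mug / 2 * `|extrapolated_y k.+1 - ys| ^+ 2
  + alpha k * beta k * eps k / 2 * (`|y k.+1| ^+ 2 - `|ys| ^+ 2)
  + delta * beta k * eps k / 2 * (`|y k.+1| ^+ 2 - `|y k| ^+ 2) <= 0.
Proof.
move=> k1; have [ffin ymin] := y_argmin k1; have [gy _] := iterate_fin k1.
have [_ gys] := saddle_point_fin pf pg hOmega.
apply: (penalized_step_descent hipY hipZ hB mug_ge0 (alpha_gt0 k1) (beta_gt0 k1)
  delta_gt0 gamma_gt0 dg_ge1 (eps_ge0 k1) hg _ ymin (y_increment k1) gys gy).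
(* Here [lamt] plus theta_k r_{k+1} is exactly lam_{k+1}. *)
move=> v; rewrite (lam_increment k1).
have -> : extrapolated_x k.+1 = x k.+1 + delta *: (Zs k.+1 - gamma *: x k.+1) by [].
have -> : extrapolated_y k.+1 = y k.+1 + delta *: (Hs k.+1 - gamma *: y k.+1) by [].
have : x k = x k.+1 - alpha k *: (Zs k.+1 - gamma *: x k.+1).
  by rewrite -x_increment // subKr.
have : y k = y k.+1 - alpha k *: (Hs k.+1 - gamma *: y k.+1).
  by rewrite -y_increment // subKr.
rewrite /residual; move: (Zs k.+1 - _) (Hs k.+1 - _) => V1 W1 -> ->.
rewrite !(linearD A, linearD B, linearN A, linearN B, linZ A, linZ B) !(dotE ipZ).
ring.
Qed.

(** Follows from alpha_k X_{k+1} = (alpha_k + delta) x_{k+1} - delta x_k and its analogue for Y. *)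
Lemma residual_increment k : (1 <= k)%N ->
  (alpha k * beta k) *: (A (extrapolated_x k.+1) + B (extrapolated_y k.+1) - b)
  = ((alpha k + delta) * beta k) *: residual k.+1 - (delta * beta k) *: residual k.
Proof.
move=> k1; rewrite /residual.
have -> : extrapolated_x k.+1 = x k.+1 + delta *: (Zs k.+1 - gamma *: x k.+1) by [].
have -> : extrapolated_y k.+1 = y k.+1 + delta *: (Hs k.+1 - gamma *: y k.+1) by [].
have : x k = x k.+1 - alpha k *: (Zs k.+1 - gamma *: x k.+1).
  by rewrite -x_increment // subKr.
have : y k = y k.+1 - alpha k *: (Hs k.+1 - gamma *: y k.+1).
  by rewrite -y_increment // subKr.
move: (Zs k.+1 - _) (Hs k.+1 - _) => V1 W1 -> ->.
rewrite !(linearD A, linearD B, linearN A, linearN B, linZ A, linZ B).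
set r := A (x k.+1) + B (y k.+1) - b.
have -> : A (x k.+1) + delta *: A V1 + (B (y k.+1) + delta *: B W1) - b
   = r + delta *: (A V1 + B W1).
  by rewrite scalerDr addrACA [LHS]addrAC.
have -> : A (x k.+1) - alpha k *: A V1 + (B (y k.+1) - alpha k *: B W1) - b
   = r - alpha k *: (A V1 + B W1).
  by rewrite scalerDr opprD addrACA [LHS]addrAC.
move: r (A V1 + B W1) => r D.
rewrite scalerBr opprB addrCA -scalerBl scalerDr !scalerA addrC.
by congr (_ *: _ + _ *: _); ring.
Qed.

(** * The energy and its one-step estimate *)

(** The Lagrangian gap at [ls], taken in the reals and meaningful where f(x_k) and g(y_k) are
    finite; the saddle point contributes no multiplier term, being feasible. *)
Definition gap k := fine (f (x k)) + fine (g (y k)) - fine (f xs) - fine (g ys)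
  + ipZ ls (residual k).

Lemma gap_ge0 k : f (x k) \is a fin_num -> g (y k) \is a fin_num -> 0 <= gap k.
Proof.
move=> fx gy; have := saddle_point_le hipZ pf pg hOmega fx gy.
rewrite /gap /residual; lra.
Qed.

Definition energy k := delta * beta k * gap k + `|lam k - ls| ^+ 2 / 2
  + (2 * delta)^-1 * (`|extrapolated_x k - xs| ^+ 2 + `|extrapolated_y k - ys| ^+ 2)
  + (delta * gamma - 1) / (2 * delta) * (`|x k - xs| ^+ 2 + `|y k - ys| ^+ 2)
  + (alpha k * beta k) ^+ 2 / 2 * `|B (extrapolated_y k - ys)| ^+ 2
  + delta * beta k * eps k / 2 * (`|x k| ^+ 2 + `|y k| ^+ 2).

(** The three conditions make the new gap coefficient fit into (alpha_k + delta) beta_k, let strong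
    convexity of g pay for the growth of the B-term, and keep the Tikhonov coefficient from
    growing. *)
Lemma energy_step k : (1 <= k)%N -> f (x k) \is a fin_num ->
  delta * beta k.+1 <= (alpha k + delta) * beta k ->
  ((alpha k.+1 * beta k.+1) ^+ 2 - (alpha k * beta k) ^+ 2) * opnorm B ^+ 2
    <= alpha k * beta k * mug ->
  beta k.+1 * eps k.+1 <= beta k * eps k ->
  energy k.+1 <= energy k + alpha k * beta k * eps k / 2 * (`|xs| ^+ 2 + `|ys| ^+ 2).
Proof.
move=> k1 fx C1 C2 C3.
have [gy fx1] := iterate_fin k1; have [gy1 _] := iterate_fin (leqW k1 : 1 <= k.+1)%N.
have := ler_wpM2r (gap_ge0 fx1 gy1) C1.
have c0 : 0 < alpha k * beta k by rewrite mulr_gt0 ?alpha_gt0 ?beta_gt0.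
have h2 : ((alpha k.+1 * beta k.+1) ^+ 2 - (alpha k * beta k) ^+ 2)
     * `|B (extrapolated_y k.+1 - ys)| ^+ 2
   <= alpha k * beta k * mug * `|extrapolated_y k.+1 - ys| ^+ 2.
  have [neg|pos] := lerP ((alpha k.+1 * beta k.+1) ^+ 2 - (alpha k * beta k) ^+ 2) 0.
    apply: (@le_trans _ _ 0); first by rewrite mulr_le0_ge0 ?exprn_ge0.
    by rewrite mulr_ge0 ?exprn_ge0 // mulr_ge0 // ltW.
  apply: le_trans (ler_wpM2r (exprn_ge0 2 (normr_ge0 _)) C2).
  rewrite -mulrA ler_pM2l // -exprMn ler_pXn2r ?nnegrE ?le_opnorm //.
  by rewrite (le_trans _ (le_opnorm hB _)).
have : delta * beta k.+1 * eps k.+1 / 2 * (`|x k.+1| ^+ 2 + `|y k.+1| ^+ 2)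
    <= delta * beta k * eps k / 2 * (`|x k.+1| ^+ 2 + `|y k.+1| ^+ 2).
  rewrite ler_wpM2r ?addr_ge0 ?exprn_ge0 // ler_wpM2r ?invr_ge0 //.
  by rewrite -!mulrA ler_wpM2l // ltW.
have : 0 <= alpha k * beta k * muf / 2 * `|extrapolated_x k.+1 - xs| ^+ 2.
  by rewrite mulr_ge0 ?exprn_ge0 // divr_ge0 // mulr_ge0 // ltW.
have : 0 <= alpha k * beta k * eps k / 2 * (`|x k.+1| ^+ 2 + `|y k.+1| ^+ 2).
  rewrite mulr_ge0 ?addr_ge0 ?exprn_ge0 // divr_ge0 // mulr_ge0 ?eps_ge0 //.
  exact: ltW.
have := x_step k1 fx; have := y_step k1.
have := multiplier_cross_term hipZ (lam k.+1 - ls) (A (extrapolated_x k.+1 - xs))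
  (B (extrapolated_y k.+1 - ys)) (B (extrapolated_y k - ys)) (alpha k * beta k).
have apE : A (extrapolated_x k.+1 - xs) + B (extrapolated_y k.+1 - ys)
    = A (extrapolated_x k.+1) + B (extrapolated_y k.+1) - b.
  rewrite -(saddle_point_feasible hipZ pf pg hOmega).
  by rewrite (linearB A) (linearB B) opprD addrACA.
have -> : lam k.+1 - ls - (alpha k * beta k) *: (A (extrapolated_x k.+1 - xs)
     + B (extrapolated_y k.+1 - ys)) = lam k - ls.
  by rewrite apE (lam_increment k1) addrAC addrK.
(* Pairing with [ls] supplies the residual parts of the gaps at k + 1 and k. *)
have := congr1 (ipZ ls) (residual_increment k1).
rewrite -apE -(linearB B).
have -> : extrapolated_y k.+1 - ys - (extrapolated_y k - ys)
    = extrapolated_y k.+1 - extrapolated_y k by rewrite opprB addrA subrK.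
rewrite /energy /gap /residual !(dotE ipZ).
move: h2; lra.
Qed.

(** * Bounds on the iterates *)

(** Lets a bound on X_k pass to x_k even when delta gamma = 1, where the energy has no term in |x_k
    - x*|^2. *)
Lemma x_average k : (1 <= k)%N -> (alpha k + delta) *: (x k.+1 - xs)
  = alpha k *: (extrapolated_x k.+1 - xs) + delta *: (x k - xs).
Proof.
move=> k1; have -> : x k = x k.+1 - alpha k *: (Zs k.+1 - gamma *: x k.+1).
  by rewrite -x_increment // subKr.
have -> : extrapolated_x k.+1 = x k.+1 + delta *: (Zs k.+1 - gamma *: x k.+1) by [].
move: (_ - gamma *: _) => V1.
rewrite (addrAC _ _ (- xs)) (addrAC _ (- (alpha k *: V1))); move: (_ - xs) => u.
by rewrite scalerDl scalerDr scalerBr !scalerA (mulrC delta) addrACA subrr addr0.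
Qed.

Lemma y_average k : (1 <= k)%N -> (alpha k + delta) *: (y k.+1 - ys)
  = alpha k *: (extrapolated_y k.+1 - ys) + delta *: (y k - ys).
Proof.
move=> k1; have -> : y k = y k.+1 - alpha k *: (Hs k.+1 - gamma *: y k.+1).
  by rewrite -y_increment // subKr.
have -> : extrapolated_y k.+1 = y k.+1 + delta *: (Hs k.+1 - gamma *: y k.+1) by [].
move: (_ - gamma *: _) => V1.
rewrite (addrAC _ _ (- ys)) (addrAC _ (- (alpha k *: V1))); move: (_ - ys) => u.
by rewrite scalerDl scalerDr scalerBr !scalerA (mulrC delta) addrACA subrr addr0.
Qed.

(** The residual identity gives delta beta_k r_k - (lam_k - ls) = (alpha_k + delta) beta_k r_{k+1} -
    (lam_{k+1} - ls), which is then scaled by delta beta_{k+1}. *)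
Lemma scaled_residual_average k : (1 <= k)%N ->
  ((alpha k + delta) * beta k) *: ((delta * beta k.+1) *: residual k.+1 - (lam k.+1 - ls))
  = ((alpha k + delta) * beta k - delta * beta k.+1) *: - (lam k.+1 - ls)
    + (delta * beta k.+1) *: ((delta * beta k) *: residual k - (lam k - ls)).
Proof.
move=> k1; have := residual_increment k1.
have -> : lam k - ls = lam k.+1 - ls - (alpha k * beta k) *:
    (A (extrapolated_x k.+1) + B (extrapolated_y k.+1) - b).
  by rewrite (lam_increment k1) addrAC addrK.
move=> ->; move: (lam k.+1 - ls) (residual k.+1) (residual k) => l r1 r0.
rewrite !(opprB, opprD, scalerBr, scalerBl, scalerDr, scalerN, opprK).
rewrite !scalerA [delta * beta k.+1 * ((alpha k + delta) * beta k)]mulrC.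
set u := _ *: r1; set v := (delta * _ * _) *: r0; set w := _ *: l; set z := (_ * _) *: l.
by rewrite (addrC v) (addrAC (u - v)) subrK addrACA subrr addr0 addrC.
Qed.

(* The energy is only controlled from index 2 on, because [f (x 1)] may be +oo. *)
Lemma energy_bound_iterates C :
  (forall k, (1 <= k)%N -> delta * beta k.+1 <= (alpha k + delta) * beta k) ->
  (forall k, (2 <= k)%N -> energy k <= C) ->
  exists2 M, 0 <= M & forall k, (2 <= k)%N ->
    [/\ `|x k| <= M, `|y k| <= M, `|lam k| <= M,
        beta k * gap k <= M & beta k * `|residual k| <= M].
Proof.
move=> C1 EC.
have terms k : (2 <= k)%N -> [/\ delta * beta k * gap k <= C, `|lam k - ls| ^+ 2 <= 2 * C,
    `|extrapolated_x k - xs| ^+ 2 <= 2 * delta * C &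
    `|extrapolated_y k - ys| ^+ 2 <= 2 * delta * C].
  case: k => // k k2; have k1 : (1 <= k.+1)%N by [].
  have := EC _ k2; rewrite /energy.
  have [gy _] := iterate_fin k1; have [_ fx] := iterate_fin (k2 : (1 <= k)%N).
  have := mulr_ge0 (mulr_ge0 (ltW delta_gt0) (ltW (beta_gt0 k1))) (gap_ge0 fx gy).
  set t1 := delta * _ * gap _.
  have := sqr_ge0 `|lam k.+1 - ls|; set t2 := `|lam _ - _| ^+ 2.
  have d2 : 0 < 2 * delta by rewrite mulr_gt0.
  have := sqr_ge0 `|extrapolated_x k.+1 - xs|; have := sqr_ge0 `|extrapolated_y k.+1 - ys|.
  set t3 := `|extrapolated_x _ - _| ^+ 2; set t4 := `|extrapolated_y _ - _| ^+ 2.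
  set t5 := (delta * gamma - 1) / _ * _.
  have : 0 <= t5 by rewrite mulr_ge0 ?addr_ge0 ?exprn_ge0 // divr_ge0 // ltW.
  set t6 := _ / 2 * `|B _| ^+ 2.
  have : 0 <= t6 by rewrite mulr_ge0 ?exprn_ge0 // divr_ge0 ?sqr_ge0.
  set t7 := delta * beta _ * eps _ / 2 * _.
  have : 0 <= t7.
    rewrite mulr_ge0 ?addr_ge0 ?exprn_ge0 // divr_ge0 // mulr_ge0 ?eps_ge0 //.
    by rewrite mulr_ge0 // ltW // beta_gt0.
  move=> p7 p6 p5 p4 p3 p2 p1 E.
  have : 0 <= (2 * delta)^-1 * t3 by rewrite mulr_ge0 // invr_ge0 ltW.
  have : 0 <= (2 * delta)^-1 * t4 by rewrite mulr_ge0 // invr_ge0 ltW.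
  move: E; rewrite mulrDr => E q4 q3.
  split; [lra | lra | |].
    by rewrite -ler_pdivrMl //; lra.
  by rewrite -ler_pdivrMl //; lra.
have sqrt_le (V : normedModType R) (v : V) a : `|v| ^+ 2 <= a -> `|v| <= Num.sqrt a.
  by move=> va; rewrite -(ger0_norm (normr_ge0 v)) -sqrtr_sqr ler_wsqrtr.
pose Mx := Num.max (Num.sqrt (2 * delta * C)) `|x 2 - xs|.
pose My := Num.max (Num.sqrt (2 * delta * C)) `|y 2 - ys|.
pose Ml := Num.sqrt (2 * C).
pose Mr := Num.max Ml `|(delta * beta 2) *: residual 2 - (lam 2 - ls)|.
have xM k : (2 <= k)%N -> `|x k - xs| <= Mx.
  apply: (@averaging_bounded _ _ (fun k => x k - xs) (fun k => extrapolated_x k.+1 - xs)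
    alpha (fun=> delta)) => // j j2; have j1 := ltnW j2.
  - by rewrite ltW ?alpha_gt0.
  - exact: x_average.
  - by apply: sqrt_le; case: (terms j.+1 (leqW j2)).
have yM k : (2 <= k)%N -> `|y k - ys| <= My.
  apply: (@averaging_bounded _ _ (fun k => y k - ys) (fun k => extrapolated_y k.+1 - ys)
    alpha (fun=> delta)) => // j j2; have j1 := ltnW j2.
  - by rewrite ltW ?alpha_gt0.
  - exact: y_average.
  - by apply: sqrt_le; case: (terms j.+1 (leqW j2)).
have lM k : (2 <= k)%N -> `|lam k - ls| <= Ml.
  by move=> k2; apply: sqrt_le; case: (terms k k2).
have rM k : (2 <= k)%N -> `|(delta * beta k) *: residual k - (lam k - ls)| <= Mr.
  apply: (@averaging_bounded _ _ (fun k => (delta * beta k) *: residual k - (lam k - ls))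
    (fun k => - (lam k.+1 - ls))
    (fun k => (alpha k + delta) * beta k - delta * beta k.+1) (fun k => delta * beta k.+1))
    => j j2; have j1 := ltnW j2.
  - by rewrite subr_ge0 C1.
  - by rewrite mulr_gt0 ?beta_gt0.
  - by rewrite subrK; exact: scaled_residual_average.
  - by rewrite normrN lM // leqW.
have nle (V : normedModType R) (u v : V) : `|u| <= `|u - v| + `|v|.
  by rewrite -{1}[u](subrK v) ler_normD.
have Ml0 : 0 <= Ml by exact: sqrtr_ge0.
have Mx0 : 0 <= Mx := le_trans (normr_ge0 _) (xM 2 isT).
have My0 : 0 <= My := le_trans (normr_ge0 _) (yM 2 isT).
have Mr0 : 0 <= Mr := le_trans (normr_ge0 _) (rM 2 isT).
have [n1 n2 n3] := And3 (normr_ge0 xs) (normr_ge0 ys) (normr_ge0 ls).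
have C0 : 0 <= C / delta.
  have [_ + _ _] := terms 2 isT; have := sqr_ge0 `|lam 2 - ls| => h1 h2.
  by rewrite divr_ge0 ?(ltW delta_gt0) //; lra.
have Q0 : 0 <= (Mr + Ml) / delta by rewrite divr_ge0 ?addr_ge0 // ltW.
exists (Mx + My + Ml + `|xs| + `|ys| + `|ls| + C / delta + (Mr + Ml) / delta).
  by rewrite !addr_ge0.
move=> k k2.
have hx := le_trans (nle _ (x k) xs) (lerD (xM k k2) (lexx _)).
have hy := le_trans (nle _ (y k) ys) (lerD (yM k k2) (lexx _)).
have hl := le_trans (nle _ (lam k) ls) (lerD (lM k k2) (lexx _)).
have hgap : beta k * gap k <= C / delta.
  by rewrite ler_pdivlMr // mulrC mulrA; case: (terms k k2).
have hr : beta k * `|residual k| <= (Mr + Ml) / delta.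
  have db : 0 < delta * beta k by rewrite mulr_gt0 // beta_gt0 // ltnW.
  rewrite ler_pdivlMr // mulrC mulrA -{1}(gtr0_norm db) -normrZ.
  exact: le_trans (nle _ _ (lam k - ls)) (lerD (rM k k2) (lM k k2)).
by split; lra.
Qed.

End iteration.

(** * The choice of parameters and the rates *)

(** Holds since 2n^3 - n^2 - n = n (n - 1) (2n + 1) >= 0. The right side telescopes, which sums the
    Tikhonov errors. *)
Lemma cubic_tail_le (R : realFieldType) (n : nat) : (1 <= n)%N ->
  1 / n%:R ^+ 3 / 2 <= n%:R^-1 - n.+1%:R^-1 :> R.
Proof.
move=> n1; have m1 : 1 <= n%:R :> R by rewrite ler1n.
rewrite -[n.+1%:R]natr1; move: n%:R m1 => m m1.
have m0 : 0 < m by lra.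
have m10 : 0 < m + 1 by lra.
have -> : m^-1 - (m + 1)^-1 = (m * (m + 1))^-1.
  by field; rewrite !gt_eqF.
rewrite -mulrA mul1r -invfM lef_pV2 ?posrE ?mulr_gt0 ?exprn_gt0 //.
have : 0 <= m * ((m - 1) * (2 * m + 1)) by rewrite !mulr_ge0 //; lra.
rewrite !exprS expr0; lra.
Qed.

Lemma bigO_inv_sqr (R : realType) (u : nat -> R) (C : R) : 0 < C ->
  (forall k, (2 <= k)%N -> `|u k| <= C / k%:R ^+ 2) ->
  (u : nat -> R^o) =O_\oo (fun k : nat => 1 / k%:R ^+ 2 : R^o).
Proof.
move=> C0 uC; apply/eqO_exP; exists C => //; exists 2 => // k /= k2.
apply: le_trans (uC k k2) _; rewrite ler_pM2l // -[leLHS]mul1r.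
exact: ler_norm.
Qed.

Theorem corollary2 (R : realType) (X Y Z : completeNormedModType R)
    (ipX : {dot X for @idfun R}) (ipY : {dot Y for @idfun R})
    (ipZ : {dot Z for @idfun R})
    (hipX : induces_norm ipX) (hipY : induces_norm ipY) (hipZ : induces_norm ipZ)
    (f : X -> \bar R) (g : Y -> \bar R)
    (A : {linear X -> Z}) (B : {linear Y -> Z}) (b : Z)
    (hA : continuous A) (hB : continuous B)
    (hS : optimal_solutions f g A B b !=set0)
    (muf mug : R) (hmuf : 0 <= muf) (hmug : 0 < mug)
    (hf : strongly_convex_class ipX muf f) (hg : strongly_convex_class ipY mug g)
    (hB0 : exists v : Y, B v != 0)
    (alpha beta eps : nat -> R)
    (hbeta : forall k, (1 <= k)%N ->
       beta k = mug * k%:R ^+ 2 / (3 * opnorm B ^+ 2))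
    (halpha : forall k, (1 <= k)%N -> alpha k = 1 / k%:R)
    (heps : forall k, (1 <= k)%N ->
       eps k = 1 / (alpha k * beta k * k%:R ^+ 3))
    (delta gamma : R) (hdelta : 0 < delta) (hgamma : 0 < gamma)
    (hdelta3 : delta <= 1 / 3) (hdg : 0 <= delta * gamma - 1)
    (x : nat -> X) (y : nat -> Y) (lam : nat -> Z)
    (Zs : nat -> X) (Hs : nat -> Y)
    (halg : primal_dual_splitting ipZ f g A B b muf mug delta gamma
              alpha beta eps x y lam Zs Hs)
    (xs : X) (ys : Y) (ls : Z)
    (hOmega : saddle_points ipZ f g A B b (xs, ys, ls)) :
  [/\ bounded_set [set (x k, y k, lam k) | k in [set k : nat | (1 <= k)%N]],
      ereal_bigO (fun k => lagrangian ipZ f g A B b (x k) (y k) ls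
                           - lagrangian ipZ f g A B b xs ys ls)%E
                 (fun k => 1 / k%:R ^+ 2),
      ereal_bigO (fun k => `| objective f g (x k) (y k) - objective f g xs ys |)%E
                 (fun k => 1 / k%:R ^+ 2) &
      (fun k : nat => `| A (x k) + B (y k) - b | : R^o)
        =O_\oo (fun k : nat => 1 / k%:R ^+ 2 : R^o) ].
Proof.
have N0 := opnorm_gt0 hB hB0.
pose N := opnorm B; pose c := mug / (3 * N ^+ 2).
have N20 : 0 < 3 * N ^+ 2 by rewrite mulr_gt0 // exprn_gt0.
have c0 : 0 < c by rewrite divr_gt0.
have cN : c * N ^+ 2 = mug / 3 by rewrite /c; field; rewrite gt_eqF.
have betaE k : (1 <= k)%N -> beta k = c * k%:R ^+ 2.
  by move=> k1; rewrite hbeta // /c mulrAC.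
have kpos k : (1 <= k)%N -> 0 < k%:R :> R by rewrite ltr0n.
have alpha_gt0 k : (1 <= k)%N -> 0 < alpha k.
  by move=> k1; rewrite halpha // divr_gt0 ?kpos.
have beta_gt0 k : (1 <= k)%N -> 0 < beta k.
  by move=> k1; rewrite betaE // mulr_gt0 ?exprn_gt0 ?kpos.
have eps_ge0 k : (1 <= k)%N -> 0 <= eps k.
  by move=> k1; rewrite heps // divr_ge0 // ltW // !mulr_gt0 ?exprn_gt0 ?kpos ?alpha_gt0 ?beta_gt0.
have abE k : (1 <= k)%N -> alpha k * beta k = c * k%:R.
  by move=> k1; rewrite halpha // betaE //; field; rewrite gt_eqF ?kpos.
have abeE k : (1 <= k)%N -> alpha k * beta k * eps k = 1 / k%:R ^+ 3.
  by move=> k1; rewrite heps // abE //; field; rewrite !gt_eqF ?kpos.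
have beE k : (1 <= k)%N -> beta k * eps k = (k%:R ^+ 2)^-1.
  move=> k1; rewrite heps // abE // betaE //; field; by rewrite !gt_eqF ?kpos.
(* Reduces to delta (2k + 1) <= k, true for delta <= 1/3 because 2k + 1 <= 3k. *)
have C1 k : (1 <= k)%N -> delta * beta k.+1 <= (alpha k + delta) * beta k.
  move=> k1; rewrite mulrDl abE // !betaE // -[k.+1%:R]natr1.
  have m1 : 1 <= k%:R :> R by rewrite ler1n.
  move: k%:R m1 => m m1.
  have : 0 <= c * (m - delta * (2 * m + 1)).
    rewrite mulr_ge0 ?(ltW c0) // subr_ge0.
    have : delta * (2 * m + 1) <= 1 / 3 * (2 * m + 1) by rewrite ler_wpM2r //; lra.
    lra.
  lra.
(* Since c N^2 = mug / 3, this is (2k + 1) / 3 <= k; the factor 3 in beta enters here. *)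
have C2 k : (1 <= k)%N ->
    ((alpha k.+1 * beta k.+1) ^+ 2 - (alpha k * beta k) ^+ 2) * opnorm B ^+ 2
    <= alpha k * beta k * mug.
  move=> k1; rewrite !abE // -[k.+1%:R]natr1 -/N.
  have m1 : 1 <= k%:R :> R by rewrite ler1n.
  move: k%:R m1 => m m1.
  have -> : ((c * (m + 1)) ^+ 2 - (c * m) ^+ 2) * N ^+ 2 = c * (c * N ^+ 2) * (2 * m + 1) by ring.
  rewrite cN.
  have : 0 <= c * mug * (m - 1) by rewrite mulr_ge0 ?subr_ge0 // ltW // mulr_gt0.
  lra.
have C3 k : (1 <= k)%N -> beta k.+1 * eps k.+1 <= beta k * eps k.
  move=> k1; rewrite !beE // lef_pV2 ?posrE ?exprn_gt0 ?kpos //.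
  by rewrite ler_pXn2r ?nnegrE // ler_nat.
pose D := `|xs| ^+ 2 + `|ys| ^+ 2.
have D0 : 0 <= D by rewrite addr_ge0 ?exprn_ge0.
pose E := energy ipZ f g A B b delta gamma alpha beta eps x y lam Zs Hs xs ys ls.
have fin := iterate_fin hf hg halg.
(* Adding D / k absorbs the errors: the sum is nonincreasing from index 2, the first where f(x_k) is
   known to be finite. *)
have EC k : (2 <= k)%N -> E k + D / k%:R <= E 2 + D / 2.
  elim: k => // k IH; rewrite leq_eqVlt => /predU1P[<-|k2] //; rewrite ltnS in k2.
  apply: le_trans (IH k2); have k1 := ltnW k2.
  have fx : f (x k) \is a fin_num.
    by case: k k2 {IH k1} => // k k1; case: (fin k k1).
  have := energy_step hipX hipY hipZ hA hB hmuf (ltW hmug) hf hg hdelta hgamma hdg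
    alpha_gt0 beta_gt0 eps_ge0 halg hOmega k1 fx (C1 k k1) (C2 k k1) (C3 k k1).
  rewrite abeE // -/E -/D.
  have := ler_wpM2r D0 (cubic_tail_le R k1).
  move: (k%:R^-1) (k.+1%:R^-1) (1 / _ / 2) => i j r. lra.
have [|M M0 HM] := energy_bound_iterates hipZ hf hg hdelta hdg alpha_gt0 beta_gt0 eps_ge0 halg hOmega (C := E 2 + D / 2) C1.
  move=> k k2; apply: le_trans (EC k k2); rewrite lerDl divr_ge0 //.
have pf : proper_efun f by case: hf.
have pg : proper_efun g by case: hg.
have [fxs gys] := saddle_point_fin pf pg hOmega.
have feas := saddle_point_feasible hipZ pf pg hOmega.
have finx k : (2 <= k)%N -> f (x k) \is a fin_num.
  by case: k => // k k1; case: (fin k k1).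
have finy k : (2 <= k)%N -> g (y k) \is a fin_num.
  by move=> k2; case: (fin k (ltnW k2)).
pose gp := gap ipZ f g A B b x y xs ys ls.
(* M + 1 instead of M keeps the rate constant positive. *)
have to_rate k (r : R) : (2 <= k)%N -> beta k * r <= M -> r <= (M + 1) / c / k%:R ^+ 2.
  move=> k2; have k1 := ltnW k2; rewrite betaE // => h.
  rewrite ler_pdivlMr ?exprn_gt0 ?kpos // ler_pdivlMr //; lra.
have gp0 k : (2 <= k)%N -> 0 <= gp k.
  by move=> k2; apply: (gap_ge0 hipZ hf hg hOmega); [exact: finx|exact: finy].
have gp_rate k : (2 <= k)%N -> `|gp k| <= (M + 1) / c / k%:R ^+ 2.
  by move=> k2; rewrite ger0_norm ?gp0 // to_rate //; case: (HM k k2).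
have res_rate k : (2 <= k)%N -> `|A (x k) + B (y k) - b| <= (M + 1) / c / k%:R ^+ 2.
  by move=> k2; rewrite to_rate //; case: (HM k k2).
have K0 : 0 < (M + 1) / c by rewrite divr_gt0 //; lra.
have lagE k : (2 <= k)%N ->
    (lagrangian ipZ f g A B b (x k) (y k) ls - lagrangian ipZ f g A B b xs ys ls)%E = (gp k)%:E.
  move=> k2; rewrite /lagrangian feas subrr (linear0r ipZ) adde0.
  rewrite -(fineK (finx k k2)) -(fineK (finy k k2)) -(fineK fxs) -(fineK gys).
  by rewrite -!EFinD; congr (_%:E); rewrite /gp /gap /residual; ring.
(* The objective difference is the gap minus <ls, r_k>, so it inherits both rates by
   Cauchy-Schwarz. *)
have objE k : (2 <= k)%N ->
    (`| objective f g (x k) (y k) - objective f g xs ys |)%E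
    = (`|gp k - ipZ ls (A (x k) + B (y k) - b)|)%:E.
  move=> k2; rewrite /objective.
  rewrite -(fineK (finx k k2)) -(fineK (finy k k2)) -(fineK fxs) -(fineK gys).
  by rewrite -!EFinD abse_EFin; congr (`|_|%:E); rewrite /gp /gap /residual; ring.
split.
(* [M] bounds the iterates from index 2 on; the first one is added by hand. *)
- pose M' := M + `|x 1%N| + `|y 1%N| + `|lam 1%N|.
  exists M'; split; first exact: num_real.
  move=> K MK _ [k /= k1 <-]; apply: le_trans (ltW MK).
  have := M0; have := normr_ge0 (x 1%N); have := normr_ge0 (y 1%N); have := normr_ge0 (lam 1%N).
  rewrite prod_normE /= prod_normE /= !ge_max /M'.
  case: (ltnP 1 k) => k2.
    by case: (HM k k2) => *; rewrite -andbA; apply/and3P; split; lra.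
  have -> : k = 1%N by apply/eqP; rewrite eqn_leq k2.
  by move=> *; rewrite -andbA; apply/and3P; split; lra.
- split; first by exists 2 => // k /= k2; rewrite lagE.
  by apply: (bigO_inv_sqr K0) => k k2; rewrite lagE //= gp_rate.
- split; first by exists 2 => // k /= k2; rewrite objE.
  have L0 : 0 < 1 + `|ls| by have := normr_ge0 ls; lra.
  apply: (bigO_inv_sqr (mulr_gt0 L0 K0)) => k k2; rewrite objE //= normr_id.
  apply: le_trans (ler_normB _ _) _; rewrite -mulrA mulrDl mul1r lerD ?gp_rate //.
  by apply: le_trans (dot_le_norm hipZ _ _) _; rewrite ler_wpM2l // res_rate.
- by apply: (bigO_inv_sqr K0) => k k2; rewrite normr_id res_rate.
Qed.
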